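(* Let $A$ be a commutative group, $L$ a loop with identity $\epsilon$, and $(P,Q)$ a loop cocycle with $P,Q:L\times L\to\mathrm{Aut}(A)$. The linear abelian extension $F(P,Q)$ has the right inverse property if and only if $L$ has the right inverse property and the identities $$P(\xi\eta,\eta^{-1})=P(\xi,\eta)^{-1},\qquad Q(\xi\eta,\eta^{-1})=P(\xi,\eta)^{-1}Q(\xi,\eta)\,P(\eta,\eta^{-1})^{-1}Q(\eta,\eta^{-1})$$ are satisfied for all $\xi,\eta\in L$.
   Context: A loop is a set with a binary multiplication having a two-sided identity element such that all left and right translations are bijections. A loop $L$ has the right inverse property if there is a bijection $\iota:L\to L$ with $yx\cdot\iota(x)=y$ for all $x,y\in L$; then left and right inverses of every $x$ coincide and $\iota(x)=x^{-1}$. Let $A=(A,+)$ be a commutative group and $L$ a loop with identity $\epsilon$. A loop cocycle is a pair $(P,Q)$ of maps $P,Q:L\times L\to\mathrm{Aut}(A)$ with $P(\alpha,\epsilon)=\mathrm{Id}=Q(\epsilon,\beta)$ for all $\alpha,\beta\in L$. The linear abelian extension $F(P,Q)$ of $A$ by $L$ is the set $L\times A$ with multiplication $(\alpha,a)\cdot(\beta,b)=(\alpha\beta,\,P(\alpha,\beta)a+Q(\alpha,\beta)b)$; it is a loop with identity $(\epsilon,0)$. Products and inverses of values of $P,Q$ are taken in the group $\mathrm{Aut}(A)$ (composition). *)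

(* Defs.v *)
From HB Require Import structures.
From mathcomp Require Import all_boot all_algebra all_fingroup.
From mathcomp Require Import boolp.

Set Implicit Arguments.
Unset Strict Implicit.
Unset Printing Implicit Defensive.

Import GRing.Theory.
Local Open Scope group_scope.

HB.mixin Record UMagma_isLoop L of UMagma L := {
  mulg_bijl : forall x : L, bijective (fun y : L => x * y);
  mulg_bijr : forall x : L, bijective (fun y : L => y * x)
}.

#[short(type="loopType")]
HB.structure Definition Loop := {L of UMagma_isLoop L & UMagma L}.

Bind Scope group_scope with Loop.sort.

Definition rip_map (L : loopType) (iota : L -> L) :=
  bijective iota /\ forall x y : L, (y * x) * iota x = y.

Definition right_inverse_property (L : loopType) :=
  exists iota : L -> L, rip_map iota.

Section LoopInverse.
Variable L : loopType.
Implicit Types x y : L.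

Lemma loop_rinv_ex x : exists y, x * y == 1.
Proof. by have [g _ gK] := mulg_bijl x; exists (g 1); rewrite gK. Qed.

(* In a general loop this is only the right inverse of x; rip_loop_inv and
   rip_mul_loop_inv show that under the right inverse property it is
   two-sided, and is the unique map witnessing that property. *)
Definition loop_inv x : L := xchoose (loop_rinv_ex x).

Lemma mulg_loop_inv x : x * loop_inv x = 1.
Proof. exact/eqP/(xchooseP (loop_rinv_ex x)). Qed.

Lemma rip_loop_inv (iota : L -> L) : rip_map iota -> iota =1 loop_inv.
Proof.
move=> [_ iotaK] x; apply: (bij_inj (mulg_bijl x)).
by rewrite mulg_loop_inv -{1}[x]mul1g iotaK.
Qed.

Lemma rip_mul_loop_inv :
  right_inverse_property L -> forall x, loop_inv x * x = 1.
Proof.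
move=> [iota ripL] x; have [_ iotaK] := ripL.
have iE := rip_loop_inv ripL.
have ii : loop_inv (loop_inv x) = x.
  have := iotaK (loop_inv x) x.
  by rewrite mulg_loop_inv mul1g iE.
by rewrite -{2}ii mulg_loop_inv.
Qed.

End LoopInverse.

Record zaut (A : zmodType) := Zaut {
  zaut_fun :> A -> A;
  zautD : {morph zaut_fun : a b / (a + b)%R};
  zaut_bij : bijective zaut_fun
}.

Section ZautGroup.
Variable A : zmodType.
Implicit Types f g h : zaut A.

Lemma zaut_ext f g : f =1 g -> f = g.
Proof.
case: f g => [f fD fb] [g gD gb] /= /funext fg.
by case: _ / fg in gD gb *; congr Zaut; apply: Prop_irrelevance.
Qed.

Lemma zaut0 f : f 0%R = 0%R.
Proof. by apply: (addrI (f 0%R)); rewrite -zautD !addr0. Qed.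

Fact zaut_nmod_morphism f : nmod_morphism f.
Proof. by split; [exact: zaut0 | exact: zautD]. Qed.

HB.instance Definition _ f :=
  GRing.isNmodMorphism.Build A A (zaut_fun f) (zaut_nmod_morphism f).

HB.instance Definition _ := gen_eqMixin (zaut A).
HB.instance Definition _ := gen_choiceMixin (zaut A).

Definition zaut_id : zaut A := @Zaut A id (fun _ _ => erefl) (inv_bij (fun=> erefl)).

Fact zaut_compD f g : {morph f \o g : a b / (a + b)%R}.
Proof. by move=> a b /=; rewrite !zautD. Qed.

Definition zaut_comp f g : zaut A :=
  Zaut (zaut_compD f g) (bij_comp (zaut_bij f) (zaut_bij g)).

Fact zaut_preimage_ex f (b : A) : exists a, f a == b.
Proof. by have [g _ gK] := zaut_bij f; exists (g b); rewrite gK. Qed.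

Definition zaut_inv_fun f (b : A) : A := xchoose (zaut_preimage_ex f b).

Lemma zaut_inv_funK f : cancel (zaut_inv_fun f) f.
Proof. by move=> b; apply/eqP/(xchooseP (zaut_preimage_ex f b)). Qed.

Lemma zaut_funK f : cancel f (zaut_inv_fun f).
Proof. by move=> a; apply: (bij_inj (zaut_bij f)); rewrite zaut_inv_funK. Qed.

Fact zaut_inv_funD f : {morph zaut_inv_fun f : a b / (a + b)%R}.
Proof.
by move=> a b; apply: (bij_inj (zaut_bij f)); rewrite zautD !zaut_inv_funK.
Qed.

Definition zaut_inv f : zaut A :=
  Zaut (@zaut_inv_funD f) (Bijective (@zaut_inv_funK f) (@zaut_funK f)).

Fact zaut_compA : associative zaut_comp. Proof. by move=> f g h; apply: zaut_ext. Qed.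
Fact zaut_1comp : left_id zaut_id zaut_comp. Proof. by move=> f; apply: zaut_ext. Qed.
Fact zaut_comp1 : right_id zaut_id zaut_comp. Proof. by move=> f; apply: zaut_ext. Qed.
Fact zaut_Vcomp : left_inverse zaut_id zaut_inv zaut_comp.
Proof. by move=> f; apply: zaut_ext; apply: zaut_funK. Qed.
Fact zaut_compV : right_inverse zaut_id zaut_inv zaut_comp.
Proof. by move=> f; apply: zaut_ext; apply: zaut_inv_funK. Qed.

HB.instance Definition _ := isGroup.Build (zaut A)
  zaut_compA zaut_1comp zaut_comp1 zaut_Vcomp zaut_compV.

Lemma zaut1E a : (1 : zaut A) a = a. Proof. by []. Qed.
Lemma zautME f g a : (f * g) a = f (g a). Proof. by []. Qed.

End ZautGroup.

Record loop_cocycle (A : zmodType) (L : loopType) := LoopCocycle {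
  cocP : L -> L -> zaut A;
  cocQ : L -> L -> zaut A;
  cocP1 : forall alpha, cocP alpha 1 = 1;
  cocQ1 : forall beta, cocQ 1 beta = 1
}.

Definition lin_ext (A : zmodType) (L : loopType) (c : loop_cocycle A L) : Type :=
  (L * A)%type.

Section LinExt.
Variables (A : zmodType) (L : loopType) (c : loop_cocycle A L).
Local Notation F := (lin_ext c).
Local Notation P := (cocP c).
Local Notation Q := (cocQ c).

HB.instance Definition _ := Choice.copy F (L * A)%type.

Definition lin_ext_mul (x y : F) : F :=
  (x.1 * y.1, (P x.1 y.1 x.2 + Q x.1 y.1 y.2)%R).

Definition lin_ext_one : F := (1, 0%R).

Fact lin_ext_mul1g : left_id lin_ext_one lin_ext_mul.
Proof. by case=> a x; rewrite /lin_ext_mul /= mul1g cocQ1 zaut0 add0r. Qed.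

Fact lin_ext_mulg1 : right_id lin_ext_one lin_ext_mul.
Proof. by case=> a x; rewrite /lin_ext_mul /= mulg1 cocP1 zaut0 addr0. Qed.

HB.instance Definition _ := hasMul.Build F lin_ext_mul.
HB.instance Definition _ := Magma_isUMagma.Build F lin_ext_mul1g lin_ext_mulg1.

Lemma lin_ext_mulE (alpha beta : L) (a b : A) :
  ((alpha, a) : F) * ((beta, b) : F) =
  (alpha * beta, (P alpha beta a + Q alpha beta b)%R).
Proof. by []. Qed.

Fact lin_ext_bijl (x : F) : bijective (fun y : F => x * y).
Proof.
case: x => alpha a; have [g gK Kg] := mulg_bijl alpha.
exists (fun y : F =>
    (g y.1, (Q alpha (g y.1))^-1 (y.2 - P alpha (g y.1) a)%R) : F).
  by case=> beta b; rewrite lin_ext_mulE /= gK addrAC subrr add0r zaut_funK.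
case=> beta b; rewrite lin_ext_mulE /= Kg; congr pair.
by rewrite zaut_inv_funK addrC subrK.
Qed.

Fact lin_ext_bijr (x : F) : bijective (fun y : F => y * x).
Proof.
case: x => beta b; have [g gK Kg] := mulg_bijr beta.
exists (fun y : F =>
    (g y.1, (P (g y.1) beta)^-1 (y.2 - Q (g y.1) beta b)%R) : F).
  by case=> alpha a; rewrite lin_ext_mulE /= gK addrK zaut_funK.
case=> alpha a; rewrite lin_ext_mulE /= Kg; congr pair.
by rewrite zaut_inv_funK subrK.
Qed.

HB.instance Definition _ := UMagma_isLoop.Build F lin_ext_bijl lin_ext_bijr.

End LinExt.

(* Main.v *)
Require Import Defs.
From HB Require Import structures.
From mathcomp Require Import all_boot all_algebra all_fingroup.
From mathcomp Require Import boolp.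
Import GRing.Theory.
Local Open Scope group_scope.

(** The right inverse property of a loop is the single identity
    [(y * x) * loop_inv x = y] ([right_inverse_propertyE]): the bijectivity
    required of the inversion map comes for free.  In the extension the
    inverse of [(eta, b)] is [(eta', - Q(eta, eta')^-1 P(eta, eta') b)] with
    [eta' = loop_inv eta] ([lin_ext_loop_inv]), so for the elements [(xi, a)]
    and [(eta, b)] the identity says, in the first coordinate, the same identity
    of [L], and in the second

      [P(xi eta, eta') (P(xi, eta) a + Q(xi, eta) b)
         - Q(xi eta, eta') Q(eta, eta')^-1 P(eta, eta') b = a].

    The two sides are additive in [(a, b)], so this holds for all [a] and [b]
    exactly when it holds for [b = 0] and for [a = 0]; these two cases are,
    after solving for [P(xi eta, eta')] and [Q(xi eta, eta')] in the group of
    automorphisms, the two identities on the cocycle. *)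

(** The identity makes inversion an involution, hence bijective: with [x'] the
    right inverse of [x] and [y] its left inverse, [x' = (y * x) * x' = y], so
    that [x' * x = 1 = x' * x''] and [x = x'']. *)
Lemma right_inverse_propertyE (L : loopType) :
  right_inverse_property L <-> forall x y : L, (y * x) * loop_inv x = y.
Proof.
split=> [[iota ripL] x y | invK].
  by rewrite -(rip_loop_inv ripL) (proj2 ripL).
have loop_invK : involutive (@loop_inv L).
  move=> x; have [g _ gK] := mulg_bijr x.
  have gE : loop_inv x = g 1 by rewrite -[RHS](invK x) gK mul1g.
  by apply: (bij_inj (mulg_bijl (loop_inv x))); rewrite mulg_loop_inv gE gK.
by exists (@loop_inv L); split; first exact: inv_bij.
Qed.

(** Setting [b = 0] determines [p'], setting [a = 0] then determines [q'], and
    additivity recovers the general case.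
    In the use made of it, the automorphisms [p, q, u, v, p', q'] are
    [P(xi, eta)], [Q(xi, eta)], [P(eta, eta')], [Q(eta, eta')],
    [P(xi eta, eta')] and [Q(xi eta, eta')]. *)
Lemma zaut_rip_identityP (A : zmodType) (p q u v p' q' : zaut A) :
  (forall a b : A, p' (p a + q b) + q' (- (v^-1 * u)%g b) = a)%R <->
  p' = p^-1 /\ q' = p^-1 * q * u^-1 * v.
Proof.
split=> [rip | [-> ->] a b].
  have p'E : p' = p^-1.
    apply: (mulIg p); rewrite mulVg; apply: zaut_ext => a.
    by have := rip a 0%R; rewrite !raddf0 !addr0.
  split=> //; rewrite -p'E; apply: (mulIg (v^-1 * u)).
  rewrite !mulgA mulgK mulgKV -mulgA; apply: zaut_ext => b.
  have := rip 0%R b.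
  by rewrite raddf0 add0r raddfN => /subr0_eq/esym.
by rewrite raddfN /= zaut_inv_funK zaut_funK zaut_inv_funD addrK zaut_funK.
Qed.

Section LinearAbelianExtension.
Variables (A : zmodType) (L : loopType) (c : loop_cocycle A L).
Local Notation F := (lin_ext c).
Local Notation P := (cocP c).
Local Notation Q := (cocQ c).

Lemma lin_ext_loop_inv (eta : L) (b : A) :
  loop_inv ((eta, b) : F) =
  (loop_inv eta,
   (- ((Q eta (loop_inv eta))^-1 * P eta (loop_inv eta))%g b)%R).
Proof.
apply: (bij_inj (mulg_bijl ((eta, b) : F))) => /=.
rewrite mulg_loop_inv lin_ext_mulE mulg_loop_inv raddfN /=.
by rewrite zaut_inv_funK subrr.
Qed.

End LinearAbelianExtension.

Theorem proposition7 (A : zmodType) (L : loopType) (c : loop_cocycle A L) :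
  right_inverse_property (lin_ext c) <->
  right_inverse_property L /\
  (forall xi eta : L,
     cocP c (xi * eta) (loop_inv eta) = (cocP c xi eta)^-1 /\
     cocQ c (xi * eta) (loop_inv eta) =
       (cocP c xi eta)^-1 * cocQ c xi eta *
       (cocP c eta (loop_inv eta))^-1 * cocQ c eta (loop_inv eta)).
Proof.
rewrite !right_inverse_propertyE; split=> [ripF | [ripL cocE] [eta b] [xi a]].
  have ripE xi eta a b := ripF (eta, b) (xi, a).
  split=> [eta xi | xi eta].
    by have := ripE xi eta 0%R 0%R; rewrite lin_ext_loop_inv => -[].
  apply/zaut_rip_identityP => a b.
  by have := ripE xi eta a b; rewrite lin_ext_loop_inv => -[].
rewrite lin_ext_loop_inv !lin_ext_mulE ripL; congr pair.
exact: (proj2 (zaut_rip_identityP _ _ _ _ _ _ _) (cocE xi eta)).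
Qed.
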